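(* Let $q\ge1$ be an integer and let $G$ be a finite graph with an ordering of its edges and an interaction energy $J_e$ at each edge $e$, equipped with a field vector $\boldsymbol{M}_i=(M_{i,1},\ldots,M_{i,q})\in\mathbb{C}^q$ at each vertex $v_i$. Then the Potts model partition function $Z_{ext}(G)$ with variable edge interaction energies and variable field admits the spanning tree expansion \[ Z_{ext}(G)=\sum_{T\in\mathcal{T}(G)}\left(\prod_{e\in\mathcal{I_I}(G,T)}(\mathrm{e}^{\beta J_e}-1)\right)\left(\prod_{e\in\mathcal{E_A}(G,T)}\mathrm{e}^{\beta J_e}\right)Z_{ext}\big(T/\mathcal{I_I}(G,T)\big), \] where $\mathcal{T}(G)$ is the set of spanning trees of $G$, and $\mathcal{I_I}(G,T)$ and $\mathcal{E_A}(G,T)$ are the sets of internally inactive and externally active edges of $G$ with respect to $T$.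
   Context: Graphs are finite and may have loops and multiple edges; $V(G)=\{v_1,\ldots,v_n\}$. $\beta$ is a fixed constant and each edge $e=\{v_i,v_j\}$ carries an interaction energy $J_e=J_{i,j}$ ($\beta$ and the $J_e$ may be taken to be complex numbers). A state of $G$ is a function $\sigma:V(G)\to\{1,\ldots,q\}$; $\sigma_i=\sigma(v_i)$; $\mathcal{S}(G)$ is the set of states; $\delta$ is the Kronecker delta. With the Hamiltonian $h(\sigma)=-\sum_{\{i,j\}\in E(G)}J_{i,j}\,\delta(\sigma_i,\sigma_j)-\sum_{v_i\in V(G)}\sum_{\alpha=1}^q M_{i,\alpha}\,\delta(\alpha,\sigma_i)$, the partition function is $Z_{ext}(G)=\sum_{\sigma\in\mathcal{S}(G)}\mathrm{e}^{-\beta h(\sigma)}$. Contraction: the field vectors are regarded as vertex weights. If $e$ is a non-loop edge with ends $v_i,v_j$, then $G/e$ is the graph obtained by contracting $e$, where the new vertex created by the contraction has weight equal to the sum of the weights of $v_i$ and $v_j$; all other vertex weights and all remaining interaction energies are unchanged. Contraction of a set of edges (here, edges of a forest) means contracting them one after another. A spanning tree $T$ of $G$ (with $G$ not necessarily connected) is an acyclic spanning subgraph whose restriction to each component of $G$ is a spanning tree of that component. Given an ordering $e_1,\ldots,e_m$ of the edges of $G$ and $T\in\mathcal{T}(G)$: for $e\in T$, the cut defined by $e$ is $\{f\in E(G): (T-e)\cup f\in\mathcal{T}(G)\}$, and $e$ is internally active if it is the smallest edge in this cut and internally inactive otherwise; for $e\notin T$, the cycle defined by $e$ is the unique cycle in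 $T\cup e$, and $e$ is externally active if it is the smallest edge in this cycle and externally inactive otherwise. The set $\mathcal{I_I}(G,T)$ consists of edges of $T$, so $T/\mathcal{I_I}(G,T)$ denotes the graph obtained from $T$ (with the vertex weights and interaction energies inherited from $G$) by contracting the edges in $\mathcal{I_I}(G,T)$. *)

(* Defs.v *)
From HB Require Import structures.
From mathcomp Require Export all_boot all_order all_algebra.
From mathcomp Require Export boolp reals sequences exp trigo.
From mathcomp Require Export complex.

Set Implicit Arguments.
Unset Strict Implicit.
Unset Printing Implicit Defensive.

Import Order.TTheory GRing.Theory Num.Theory.
Local Open Scope ring_scope.

Definition cexp (R : realType) (z : R[i]) : R[i] :=
  let: Complex x y := z in Complex (expR x * cos y) (expR x * sin y).

(* A finite multigraph with interaction energies and field vectors.  Edges are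
   labelled by elements of a finite type E that is shared by a graph and all
   its minors; the edges of the graph are the labels in [edges], and the values
   of [ends] and [energy] at other labels are irrelevant.  [ends e] lists the
   two ends of e in an arbitrary order; e is a loop when they are equal. *)
Record potts_graph (C : pzRingType) (q : nat) (E : finType) := PottsGraph {
  vert : finType;
  edges : {set E};
  ends : E -> vert * vert;
  energy : E -> C;
  field_vec : vert -> 'rV[C]_q
}.
Arguments field_vec {C q E} p _.

Section PartitionFunction.
Variables (R : realType) (q : nat) (E : finType) (beta : R[i]).
Variable G : potts_graph R[i] q E.

(* The q spins are numbered 0, ..., q - 1. *)
Definition state := {ffun vert G -> 'I_q}.

Definition hamiltonian (sigma : state) : R[i] :=
  - (\sum_(e in edges G)
       energy G e * (sigma (ends G e).1 == sigma (ends G e).2)%:R)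
  - \sum_(v : vert G) \sum_(a < q) field_vec G v 0 a * (a == sigma v)%:R.

Definition Zext : R[i] := \sum_(sigma : state) cexp (- beta * hamiltonian sigma).

End PartitionFunction.

Section Contraction.
Variables (C : pzRingType) (q : nat) (E : finType).
Implicit Type G : potts_graph C q E.

Definition is_end G e (x : vert G) :=
  (x == (ends G e).1) || (x == (ends G e).2).

(* Vertices of G / e: [Some x] for x not an end of e, and [None] for the vertex
   created by the contraction. *)
Definition contract_vert G e : finType := option {x : vert G | ~~ is_end e x}.

(* [insub] sends the ends of e to [None] and any other x to [Some x]. *)
Definition contract_map G e : vert G -> contract_vert G e :=
  fun x => insub x.

(* Meaningful only when e is a non-loop edge of G. *)
Definition contract G e : potts_graph C q E :=
  @PottsGraph C q E (contract_vert G e) (edges G :\ e)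
    (fun f => (contract_map e (ends G f).1, contract_map e (ends G f).2))
    (energy G)
    (fun y => if y is Some x then field_vec G (val x)
              else field_vec G (ends G e).1 + field_vec G (ends G e).2).

(* The edges of A are contracted one after another; the order (here that of
   [enum A]) only affects the result up to isomorphism when A is a forest. *)
Definition contract_set G (A : {set E}) : potts_graph C q E :=
  foldl contract G (enum A).

Definition spanning_subgraph G (A : {set E}) : potts_graph C q E :=
  @PottsGraph C q E (vert G) A (ends G) (energy G) (field_vec G).

End Contraction.

Section SpanningTrees.
Variables (C : pzRingType) (q : nat) (E : finType).
Variable G : potts_graph C q E.
Implicit Types (A T : {set E}) (K : {set vert G}).

Definition joins (e : E) : rel (vert G) :=
  fun x y => (ends G e == (x, y)) || (ends G e == (y, x)).

Definition adj A : rel (vert G) := fun x y => [exists e in A, joins e x y].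

Definition component (x : vert G) : {set vert G} :=
  [set y | connect (adj (edges G)) x y].

(* Cycles as edge sets: k = 1 gives loops and k = 2 gives pairs of parallel
   edges ([ordS] is the cyclic successor on 'I_k). *)
Definition is_cycle A : Prop :=
  exists (k : nat) (v : 'I_k -> vert G) (e : 'I_k -> E),
    [/\ (0 < k)%N, injective v, injective e,
        forall i, joins (e i) (v i) (v (ordS i)) &
        A = [set e i | i : 'I_k]].

Definition acyclic A : Prop := forall A', A' \subset A -> ~ is_cycle A'.

Definition edges_within A K : {set E} :=
  [set e in A | ((ends G e).1 \in K) && ((ends G e).2 \in K)].

Definition is_tree_on K A : Prop :=
  acyclic A /\ {in K &, forall x y, connect (adj A) x y}.

Definition is_spanning_tree T : Prop :=
  [/\ T \subset edges G, acyclic T &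
      forall x, is_tree_on (component x) (edges_within T (component x))].

Definition spanning_trees : {set {set E}} := [set T | `[< is_spanning_tree T >]].

Definition cut T e : {set E} :=
  [set f in edges G | f |: (T :\ e) \in spanning_trees].

(* The cycle contained in T + e; it exists and is unique when T is a spanning
   tree and e is an edge outside T. *)
Definition cycle_of T e : {set E} :=
  odflt set0 [pick A : {set E} | (A \subset e |: T) && `[< is_cycle A >]].

(* An ordering e_1, ..., e_m of the edges is given by the list of the edges. *)
Variable s : seq E.

Definition is_smallest (A : {set E}) e : bool :=
  (e \in A) && [forall f in A, (index e s <= index f s)%N].

Definition int_active T : {set E} := [set e in T | is_smallest (cut T e) e].

Definition int_inactive T : {set E} := T :\: int_active T.

Definition ext_active T : {set E} :=
  [set e in edges G :\: T | is_smallest (cycle_of T e) e].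

End SpanningTrees.

(* Main.v *)
(* Summing over subsets of edges, exp(-beta h) is a field weight times the
   product over the edges of 1 + t_e, where t_e is exp(beta J_e) - 1 if the ends
   of e have equal spins and 0 otherwise.  Crapo's interval partition of the
   subsets of E(G) rewrites this product, for each fixed state, as the sum over
   the spanning trees T of the product of t_e over II(T) times that of 1 + t_e
   over (T u EA(T)) \ II(T).  The summand of T vanishes unless the state is
   constant along II(T), and such states are the states of T / II(T).  Every
   cycle defined by an externally active edge e lies in II(T) + e, so the factor
   1 + t_e is then exp(beta J_e).

   Crapo's partition itself comes from the uniqueness of greedy trees: A lies in
   [II(T), T u EA(T)] exactly when T is greedy for an order depending on A.

   Two vertices are connected in (V, A) exactly when no colouring of V that is
   constant along the edges of A separates them; this replaces most arguments
   on paths. *)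

Require Import Defs.
From mathcomp Require Import all_boot all_order all_algebra.
From mathcomp Require Import boolp reals sequences exp trigo complex.
From mathcomp Require Import zify ring.

Set Implicit Arguments.
Unset Strict Implicit.
Unset Printing Implicit Defensive.

Import Order.TTheory GRing.Theory Num.Theory.
Local Open Scope ring_scope.

(** * Forests and spanning trees *)

Section Connectivity.
Variables (C : pzRingType) (q : nat) (E : finType) (G : potts_graph C q E).
Implicit Types (A B T : {set E}) (e f : E) (x y z : vert G).

(** For an edge e, membership in the closure of A in the cycle matroid of G. *)
Definition linked A e := connect (adj A) (ends G e).1 (ends G e).2.

(** Independence in the same matroid; [acyclicP] identifies it with the absence of cycles. *)
Definition forest A := [forall e in A, ~~ linked (A :\ e) e].

Lemma adj_sym A : symmetric (@adj _ _ _ G A).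
Proof.
by move=> x y; apply: eq_existsb => e; rewrite /joins orbC.
Qed.

Lemma conn_sym A x y : connect (adj A) x y = connect (adj A) y x.
Proof. exact/sym_connect_sym/adj_sym. Qed.

Lemma linked1 A e : e \in A -> linked A e.
Proof.
move=> eA; apply: connect1; apply/exists_inP; exists e => //.
by rewrite /joins -surjective_pairing eqxx.
Qed.

Lemma conn_colouring (X : Type) (g : vert G -> X) A x y :
    (forall e, e \in A -> g (ends G e).1 = g (ends G e).2) ->
  connect (adj A) x y -> g x = g y.
Proof.
move=> gA /connectP[p]; elim: p x => [|z p IH] x /=; first by move=> _ ->.
case/andP=> /exists_inP[e eA xz] zp ly; rewrite -(IH z) //.
by case/orP: xz => /eqP def; have := gA e eA; rewrite def.
Qed.

Lemma conn_saturated A x e :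
  linked A e ->
  connect (adj A) x (ends G e).1 = connect (adj A) x (ends G e).2.
Proof.
by move=> le; apply: same_connect_r le _; apply/sym_connect_sym/adj_sym.
Qed.

(** The colouring [connect (adj B) x] is constant along the edges of A and true at x, hence true at
    y. *)
Lemma conn_sub A B x y :
    (forall e, e \in A -> linked B e) ->
  connect (adj A) x y -> connect (adj B) x y.
Proof.
move=> AB /(@conn_colouring _ (connect (adj B) x)) <- // e /AB.
exact: conn_saturated.
Qed.

Lemma connS A B x y :
  A \subset B -> connect (adj A) x y -> connect (adj B) x y.
Proof. by move=> /subsetP AB; apply: conn_sub => e /AB /linked1. Qed.

Lemma linkedS A B e : A \subset B -> linked A e -> linked B e.
Proof. exact: connS. Qed.

Lemma conn_setU1 A e x y :
  linked A e -> connect (adj (e |: A)) x y -> connect (adj A) x y.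
Proof.
move=> le; apply: conn_sub => f /setU1P[-> //|]; exact: linked1.
Qed.

(** Otherwise reachability from x in A is false at both ends of e, so it is constant along e as well
    and separates x from y. *)
Lemma conn_setU1_cross A e x y :
    connect (adj (e |: A)) x y -> ~~ connect (adj A) x y ->
  connect (adj A) x (ends G e).1 || connect (adj A) x (ends G e).2.
Proof.
move=> exy; apply: contraR; rewrite negb_or => /andP[/negPf x1 /negPf x2].
rewrite -(@conn_colouring _ (connect (adj A) x) _ _ _ _ exy) // => f /setU1P[->|fA].
  by rewrite x1 x2.
exact/conn_saturated/linked1.
Qed.

(** Exchange property of the closure. In A each end of f reaches an end of e, and not the same one
    because A does not link f; so f joins the two ends of e. *)
Lemma linked_exchange A e f :
    linked (e |: A) f -> ~~ linked A f -> linked (f |: A) e.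
Proof.
move=> lf nf; have fA : A \subset f |: A by apply: subsetUr.
have := conn_setU1_cross lf nf.
have lf' : connect (adj (e |: A)) (ends G f).2 (ends G f).1 by rewrite conn_sym.
have nf' : ~~ connect (adj A) (ends G f).2 (ends G f).1 by rewrite conn_sym.
have := conn_setU1_cross lf' nf'.
have lff : linked (f |: A) f by apply/linked1/setU11.
rewrite /linked in lff nf *.
case/orP=> c2 /orP[c1|c1].
- by case/negP: nf; apply: connect_trans c1 _; rewrite conn_sym.
- apply: connect_trans (connS fA c1); rewrite conn_sym in lff.
  by apply: connect_trans lff; rewrite conn_sym (connS fA).
- apply: connect_trans (connS fA c2); apply: connect_trans lff.
  by rewrite conn_sym (connS fA).
- by case/negP: nf; apply: connect_trans c1 _; rewrite conn_sym.
Qed.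

(** * Forests and cycles *)

Lemma forestP A : reflect (forall e, e \in A -> ~~ linked (A :\ e) e) (forest A).
Proof. exact: forall_inP. Qed.

Lemma forestS A B : A \subset B -> forest B -> forest A.
Proof.
move=> AB /forestP fB; apply/forestP => e eA.
by apply: contra (fB e (subsetP AB e eA)); apply/linkedS/setSD.
Qed.

(** If adding e made some f in A linked by the other edges, the exchange property would make e
    linked by A. *)
Lemma forestU1 A e : forest A -> ~~ linked A e -> forest (e |: A).
Proof.
move=> /forestP fA ne; apply/forestP => f.
have [->|nfe] := eqVneq f e.
  by move=> _; apply: contra ne; apply: linkedS; rewrite subDset.
rewrite in_setU1 (negPf nfe) /= => fAi; apply: contra ne => lf.
have -> : A = f |: (A :\ f) by rewrite setD1K.
apply: linked_exchange (fA f fAi); apply: linkedS lf.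
by rewrite setDUl setSU // subsetDl.
Qed.

Lemma cycle_linked A f : is_cycle G A -> f \in A -> linked (A :\ f) f.
Proof.
case=> k [v [e [_ _ injE ve ->]]] /imsetP[i0 _ ->].
set B := _ :\ _.
have stepB i : i != i0 -> connect (adj B) (v i) (v (ordS i)).
  move=> ni; apply: connect1; apply/exists_inP; exists (e i); last exact: ve.
  by rewrite !inE (inj_eq injE) ni imset_f.
(* The walk round the cycle from [ordS i0] first returns to [i0] after m steps; minimality keeps it
   off the edge [e i0] until then. *)
have [m Pm mmin] : {m | iter m (@ordS k) (ordS i0) == i0 &
    forall m', iter m' (@ordS k) (ordS i0) == i0 -> (m <= m')%N}.
  have ex : exists m, iter m (@ordS k) (ordS i0) == i0.
    exists (findex (@ordS k) (ordS i0) i0); apply/eqP/iter_findex.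
    by rewrite fconnect_sym ?fconnect1 //; apply: ordS_inj.
  by case: (ex_minnP ex) => m ? ?; exists m.
have run j : (j <= m)%N ->
    connect (adj B) (v (ordS i0)) (v (iter j (@ordS k) (ordS i0))).
  elim: j => [//|j IH] jm; apply: connect_trans (IH (ltnW jm)) _.
  by apply: stepB; apply: contraL jm => /mmin; rewrite -leqNgt.
have := run m (leqnn m); rewrite (eqP Pm).
by case/orP: (ve i0) => /eqP; rewrite /linked => -> //=; rewrite conn_sym.
Qed.

(** A repetition-free path between the ends of e that avoids e is closed by e to a cycle. *)
Lemma linked_cycle A e :
  e \in A -> linked (A :\ e) e -> exists2 A' : {set E}, A' \subset A & is_cycle G A'.
Proof.
move=> eA /connectP[p0 /shortenP[p pp up _] lp]; move: up pp lp.
set a := (ends G e).1; set b := (ends G e).2 => up pp lp.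
pose v := nth a (a :: p).
have step i : (i < size p)%N -> {f | f \in A :\ e & joins f (v i) (v i.+1)}.
  move=> ip; have := (pathP a pp) i ip; rewrite -/(v i) => /exists_inP h.
  by apply: sig2W => //; case: h => f; exists f.
(* [d i] is the i-th edge of the path, and the closing edge e at index [size p]. The match on a
   reflection keeps the proof that [step] needs. *)
pose d i := if (i < size p)%N =P true is ReflectT h then s2val (step i h) else e.
have dP i : (i < size p)%N -> d i \in A :\ e /\ joins (d i) (v i) (v i.+1).
  by rewrite /d; case: eqP => // h _; case: (step i h).
have de i : (size p <= i)%N -> d i = e.
  by rewrite /d; case: eqP => // h; rewrite leqNgt h.
have vinj i j : (i <= size p)%N -> (j <= size p)%N -> v i = v j -> i = j.
  by move=> hi hj /eqP; rewrite nth_uniq // => /eqP.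
have full (i : 'I_(size p).+1) : (size p <= i)%N -> i = size p :> nat.
  by move=> ip; apply/eqP; rewrite eqn_leq ip -ltnS ltn_ord.
exists [set d i | i : 'I_(size p).+1].
  apply/subsetP => _ /imsetP[i _ ->].
  have [/dP[/setD1P[_ //]]|/de -> //] := ltnP i (size p).
exists (size p).+1, (fun i => v i), (fun i => d i); split => //.
- by move=> i j /vinj h; apply: val_inj; apply: h; rewrite -ltnS.
- move=> i j dij; apply: val_inj => /=.
  have [ip|ip] := ltnP i (size p); have [jp|jp] := ltnP j (size p).
  + have [_] := dP i ip; have [_] := dP j jp; rewrite dij /joins.
    (* Traversing one edge in opposite directions would give both i = j + 1 and j = i + 1. *)
    move=> /orP[]/eqP-> /orP[]/eqP[h1 h2].
    * by rewrite (vinj _ _ _ _ h1) // ltnW.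
    * have := vinj _ _ (ltnW jp) ip h1; have := vinj _ _ jp (ltnW ip) h2; lia.
    * have := vinj _ _ jp (ltnW ip) h1; have := vinj _ _ (ltnW jp) ip h2; lia.
    * by rewrite (vinj _ _ _ _ h2) // ltnW.
  + by have [] := dP i ip; rewrite dij (de _ jp) !inE eqxx.
  + by have [] := dP j jp; rewrite -dij (de _ ip) !inE eqxx.
  + by rewrite (full _ ip) (full _ jp).
- move=> i /=; have [ip|ip] := ltnP i (size p).
    by rewrite modn_small //; have [] := dP i ip.
  (* At the last index [ordS] wraps round to 0, and e joins b back to a. *)
  rewrite (full _ ip).
  rewrite modnn de // /joins {2}/v /= -/a.
  have -> : v (size p) = b by rewrite lp /v -[size p]/(size (a :: p)).-1 nth_last.
  by rewrite -surjective_pairing eqxx orbT.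
Qed.

Lemma acyclicP A : acyclic G A <-> forest A.
Proof.
split=> [acA|fA A' sA' cA'].
  apply/forestP => e eA; apply/negP => le.
  by have [A' sA' cA'] := linked_cycle eA le; apply: acA cA'.
have /forestP fA' := forestS sA' fA.
have [f fA1] : exists f, f \in A'.
  by case: cA' => -[|k] [v [e [//= _ _ _ _ ->]]]; exists (e ord0); apply: imset_f.
by have := fA' f fA1; rewrite cycle_linked.
Qed.

(** * Spanning trees, cuts and fundamental cycles *)

Lemma spanning_treeP T :
  reflect [/\ T \subset edges G, forest T & forall e, e \in edges G -> linked T e]
          (T \in spanning_trees G).
Proof.
rewrite inE; apply: (iffP (asboolP _)) => [[sT /acyclicP fT tT]|[sT fT lT]].
  split=> // e eG; have [_ h] := tT (ends G e).1.
  apply: connS (h _ _ _ _); rewrite ?inE ?connect0 //; last exact: linked1.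
  by apply/subsetP => f; rewrite !inE; case/andP.
split=> //; first exact/acyclicP.
move=> x; set K := component x; split.
  apply/acyclicP; apply: forestS fT.
  by apply/subsetP => f; rewrite inE; case/andP.
move=> y z yK zK; set B := edges_within T K.
have Kends f : f \in T -> ((ends G f).1 \in K) = ((ends G f).2 \in K).
  by move=> fT'; rewrite !inE; apply/conn_saturated/linked1/(subsetP sT).
have yz : connect (adj T) y z.
  apply: (conn_sub lT); move: yK zK; rewrite !inE conn_sym.
  exact: connect_trans.
(* Reachability inside the component K, extended by false outside, is constant along every edge of
   T, since no edge of T leaves K. *)
pose g w := (w \in K) && connect (adj B) y w.
have : g y = g z.
  apply: conn_colouring yz => f fT'; rewrite /g -(Kends f fT').
  case fK : (_ \in K) => //=; apply/conn_saturated/linked1.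
  by rewrite inE fT' -Kends // fK.
by rewrite /g yK connect0 /= => /esym/andP[].
Qed.

Lemma spanning_tree_exists : exists T, T \in spanning_trees G.
Proof.
(* The tree is a smallest set of edges that links every edge of G: an edge linked by the others
   could be dropped. *)
pose P T := (T \subset edges G) && [forall e in edges G, linked T e].
have PG : P (edges G) by rewrite /P subxx; apply/forall_inP => e /linked1.
case: (arg_minnP (fun T => #|T|) PG) => T /andP[sT /forall_inP lT] Tmin.
exists T; apply/spanning_treeP; split=> //; apply/forestP => e eT.
apply/negP => le; have /Tmin : P (T :\ e).
  rewrite /P (subset_trans (subsetDl _ _) sT); apply/forall_inP => f /lT lf.
  by apply: conn_setU1 le _; rewrite setD1K.
by rewrite (cardsD1 e T) eT ltnn.
Qed.

(** For f in T other than e, the exchanged set would be just [T :\ e], which does not link e. *)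
Lemma cutP T e f :
    T \in spanning_trees G -> e \in T -> f \in Defs.cut G T e ->
  f = e \/ f \in edges G :\: T.
Proof.
move=> /spanning_treeP[sT /forestP fT lT] eT.
rewrite inE => /andP[fG /spanning_treeP[_ _ lT']].
have [->|nfe] := eqVneq f e; [by left | right].
rewrite inE fG andbT; apply: contra (fT e eT) => fT'.
have := lT' e (subsetP sT e eT); apply: linkedS.
by rewrite subUset subxx sub1set !inE nfe fT'.
Qed.

Lemma cut_refl T e : T \in spanning_trees G -> e \in T -> e \in Defs.cut G T e.
Proof.
move=> TT eT; rewrite inE setD1K // TT andbT.
by case/spanning_treeP: TT => /subsetP->.
Qed.

Lemma cycle_ofP T e :
    T \in spanning_trees G -> e \in edges G :\: T ->
  is_cycle G (cycle_of G T e) /\ cycle_of G T e \subset e |: T.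
Proof.
move=> /spanning_treeP[_ _ lT] /setDP[eG eT]; rewrite /cycle_of.
(* The default [set0] never occurs: T links e, so [e |: T] contains a cycle. *)
case: pickP => [A /andP[sA /asboolP cA] //|none].
have [||A sA cA] := @linked_cycle (e |: T) e; first exact: setU11.
  by rewrite setU1K // lT.
by have := none A; rewrite sA /= asboolT.
Qed.

Lemma mem_cycle_of T e :
    T \in spanning_trees G -> e \in edges G :\: T -> e \in cycle_of G T e.
Proof.
move=> TT eT; have [cA sA] := cycle_ofP TT eT.
have [_ /acyclicP acT _] := spanning_treeP _ TT.
apply/negP => /negP neA; apply: (acT _ _ cA).
apply/subsetP => f fA; move/(subsetP sA): (fA); rewrite inE => /orP[|//].
by rewrite inE => /eqP fe; case/negP: neA; rewrite -{1}fe.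
Qed.

(** Duality of fundamental cycles and cuts. If f is off the cycle, the exchanged set still contains
    the cycle and is no tree. If f is on it, the rest of the cycle links f through e, so the
    exchanged set links all that T does; and [T :\ f] does not link e, as it would then link f. *)
Lemma cycle_of_cut T e f :
    T \in spanning_trees G -> e \in edges G :\: T -> f != e ->
  (f \in cycle_of G T e) = (f \in T) && (e \in Defs.cut G T f).
Proof.
move=> TT eT nfe; have [cA sA] := cycle_ofP TT eT.
have [sT fT lT] := spanning_treeP _ TT; have [eG neT] := setDP eT.
apply/idP/andP => [fA|[fT' ecut]]; last first.
  apply/negP => /negP nfA; move: ecut; rewrite inE => /andP[_ /spanning_treeP].
  case=> _ /acyclicP acT' _; apply: acT' cA.
  apply/subsetP => g gA; move/(subsetP sA): (gA); rewrite !inE.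
  have [gf|//] := eqVneq g f.
  by rewrite -gf gA in nfA.
have fT' : f \in T.
  by move/(subsetP sA): fA; rewrite !inE (negPf nfe).
have lf : linked (e |: (T :\ f)) f.
  apply: linkedS (cycle_linked cA fA); apply/subsetP => g /setD1P[gf /(subsetP sA)].
  by rewrite !inE gf.
split=> //; rewrite inE eG; apply/spanning_treeP; split.
- by rewrite subUset sub1set eG (subset_trans (subsetDl _ _)).
- apply: forestU1; first exact: forestS (subsetDl _ _) fT.
  move/forestP: fT => /(_ f fT'); apply: contra => le; exact: conn_setU1 le lf.
- move=> g /lT lg; apply: conn_setU1 lf _; apply: connS lg.
  by rewrite setUCA setD1K // subsetUr.
Qed.

(** The cycle that e closes in T' is not contained in the forest T, so it has an edge f outside
    T. *)
Lemma spanning_tree_exchange T T' e :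
    T \in spanning_trees G -> T' \in spanning_trees G -> e \in T :\: T' ->
  exists2 f, f \in T' :\: T & e \in Defs.cut G T' f.
Proof.
move=> TT TT' /setDP[eT neT'].
have [sT /acyclicP acT _] := spanning_treeP _ TT.
have eD : e \in edges G :\: T' by rewrite inE neT' (subsetP sT).
have [cA sA] := cycle_ofP TT' eD.
have /subsetPn[f fA nfT] : ~~ (cycle_of G T' e \subset T).
  by apply/negP => /acT; apply.
have nfe : f != e by apply: contraNneq nfT => ->.
move: fA; rewrite cycle_of_cut // => /andP[fT' ecut].
by exists f; rewrite // inE nfT.
Qed.

(** Take e of least rank in the symmetric difference and exchange it for an f of the other tree.
    Greediness gives r f <= r e and minimality the converse, so f = e, although e and f lie in
    different trees. *)
Lemma greedy_tree_unique (r : E -> nat) T T' :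
    {in edges G &, injective r} ->
    T \in spanning_trees G -> T' \in spanning_trees G ->
    (forall e f, e \in T -> f \in Defs.cut G T e -> (r e <= r f)%N) ->
    (forall e f, e \in T' -> f \in Defs.cut G T' e -> (r e <= r f)%N) ->
  T = T'.
Proof.
move=> rinj TT TT' gT gT'; apply/eqP/negP => /negP neq.
pose D := (T :\: T') :|: (T' :\: T).
have [e0 e0D] : exists e, e \in D.
  apply/set0Pn; apply: contra neq; rewrite setU_eq0 !setD_eq0.
  by rewrite -eqEsubset.
case: (arg_minnP r e0D) => e eD emin.
(* Stated for an arbitrary pair of trees, since e may lie in T or in T'. *)
have key S S' : S \in spanning_trees G -> S' \in spanning_trees G ->
    (forall e f, e \in S' -> f \in Defs.cut G S' e -> (r e <= r f)%N) ->
    (forall f, f \in S' :\: S -> (r e <= r f)%N) -> e \in S :\: S' -> False.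
  move=> SS SS' gS' smin eS.
  have [f fS ecut] := spanning_tree_exchange SS SS' eS.
  have [sS _ _] := spanning_treeP _ SS; have [sS' _ _] := spanning_treeP _ SS'.
  move: (fS) (eS) => /setDP[fS1 nfS] /setDP[eS1 neS].
  have fe : f = e.
    apply: rinj; [exact: subsetP fS1 | exact: subsetP eS1 | ].
    by apply/eqP; rewrite eqn_leq gS' //= smin.
  by rewrite fe eS1 in nfS.
have emin1 f : f \in T' :\: T -> (r e <= r f)%N.
  by move=> fD; apply/emin/setUP; right.
have emin2 f : f \in T :\: T' -> (r e <= r f)%N.
  by move=> fD; apply/emin/setUP; left.
by case/setUP: eD => eD; [apply: (key T T') | apply: (key T' T)].
Qed.

Lemma greedy_tree_exists (r : E -> nat) :
  exists2 T, T \in spanning_trees G &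
    forall e f, e \in T -> f \in Defs.cut G T e -> (r e <= r f)%N.
Proof.
have [T0 TT0] := spanning_tree_exists.
(* In a tree of least total rank no exchange along a cut can lower the rank. *)
case: (arg_minnP (fun T : {set E} => (\sum_(e in T) r e)%N) TT0) => T TT Tmin.
exists T => // e f eT fcut; have [->//|/setDP[_ nfT]] := cutP TT eT fcut.
move: fcut; rewrite inE => /andP[_ /Tmin].
rewrite big_setU1 /=; last by rewrite !inE negb_and nfT orbT.
by rewrite (big_setD1 e eT) /= leq_add2r.
Qed.

End Connectivity.

(** * Crapo's interval partition *)

Lemma prod_subset_interval (R : comPzRingType) (E : finType) (t : E -> R)
    (L U : {set E}) :
    L \subset U ->
  (\prod_(e in L) t e) * (\prod_(e in U :\: L) (1 + t e)) =
  \sum_(A : {set E} | (L \subset A) && (A \subset U)) \prod_(e in A) t e.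
Proof.
(* [F e] and [H e] are the factors for e in A and e not in A. They vanish where the interval forbids
   that choice, so distributing the product leaves only the A between L and U. *)
move=> LU; pose F e := if e \in U then t e else 0.
pose H e : R := if e \in L then 0 else 1.
transitivity (\prod_e (F e + H e)).
  rewrite [RHS](bigID (mem U)) /= [X in _ = _ * X]big1 ?mulr1; last first.
    move=> e /negPf neU; rewrite /F /H neU add0r ifN //.
    by apply: contraFN neU; apply: (subsetP LU).
  rewrite [RHS](big_setID L) /= (setIidPr LU); congr (_ * _); apply: eq_bigr => e.
    by move=> eL; rewrite /F /H eL (subsetP LU) // addr0.
  by move=> /setDP[eU /negPf neL]; rewrite /F /H eU neL addrC.
rewrite bigA_distr (bigID (fun A : {set E} => (L \subset A) && (A \subset U))) /=.
rewrite [X in _ + X]big1 ?addr0.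
  apply: eq_bigr => A /andP[LA AU].
  rewrite (bigID (mem A)) /= [X in _ * X]big1 ?mulr1.
    by apply: eq_bigr => e eA; rewrite eA /F (subsetP AU).
  move=> e neA; rewrite (negPf neA) /H ifN //; apply: contra neA.
  exact: (subsetP LA).
move=> A; rewrite negb_and => /orP[] /subsetPn[e e1 e2].
  by rewrite (bigD1 e) //= (negPf e2) /H e1 mul0r.
by rewrite (bigD1 e) //= e1 /F (negPf e2) mul0r.
Qed.

Section Activities.
Variables (C : pzRingType) (q : nat) (E : finType) (G : potts_graph C q E).
Variable s : seq E.
Hypothesis s_edges : s =i edges G.
Implicit Types (A T : {set E}) (e f : E).

Local Notation II := (int_inactive G s).
Local Notation EA := (ext_active G s).

Lemma index_edges_inj : {in edges G &, injective (index^~ s)}.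
Proof. by move=> e f eG fG; apply: (index_inj e); rewrite s_edges. Qed.

Lemma int_activeP T e :
    T \in spanning_trees G -> e \in T ->
  reflect (forall f, f \in Defs.cut G T e -> (index e s <= index f s)%N)
          (e \in int_active G s T).
Proof.
move=> TT eT; rewrite inE eT /is_smallest cut_refl //=; exact: forall_inP.
Qed.

(** By cycle-cut duality, external activity is expressed through cuts of tree edges, so that both
    activities concern the same pairs of edges. *)
Lemma ext_activeP T e :
    T \in spanning_trees G -> e \in edges G :\: T ->
  reflect (forall f, f \in T -> e \in Defs.cut G T f -> (index e s <= index f s)%N)
          (e \in EA T).
Proof.
move=> TT eT; rewrite inE eT /is_smallest mem_cycle_of //=.
apply: (iffP forall_inP) => h f; last first.
  by have [->//|nfe] := eqVneq f e; rewrite cycle_of_cut // => /andP[]; apply: h.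
move=> fT ecut; apply: h; rewrite cycle_of_cut ?fT //.
by case/setDP: eT => _; apply: contraNneq => <-.
Qed.

(** If f were internally active it would precede e, which lies in its cut; but e precedes f by
    external activity. *)
Lemma cycle_of_ext_active T e f :
    T \in spanning_trees G -> e \in EA T -> f \in cycle_of G T e -> f != e ->
  f \in II T.
Proof.
move=> TT eEA fC nfe; have eT : e \in edges G :\: T by case/setIdP: eEA.
move: fC; rewrite cycle_of_cut // => /andP[fT ecut].
rewrite inE fT andbT; apply/negP => /int_activeP - /(_ TT fT) /(_ e ecut) le1.
have le2 := ext_activeP TT eT eEA f fT ecut.
case/negP: nfe; apply/eqP; apply: index_edges_inj.
- by have [/subsetP-> ] := spanning_treeP _ _ TT.
- by case/setDP: eT.
- by apply/eqP; rewrite eqn_leq le1.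
Qed.

Lemma ext_active_linked T e :
  T \in spanning_trees G -> e \in EA T -> linked G (II T) e.
Proof.
move=> TT eEA; have eT : e \in edges G :\: T by case/setIdP: eEA.
have [cA _] := cycle_ofP TT eT.
apply: linkedS (cycle_linked cA (mem_cycle_of TT eT)).
by apply/subsetP => f /setD1P[nfe fC]; apply: cycle_of_ext_active fC nfe.
Qed.

Lemma index_le e : (index e s <= size s)%N.
Proof. exact: index_size. Qed.

(* The trees whose interval contains A are the greedy trees for the order in
   which A comes first, in decreasing order, and its complement comes next, in
   increasing order. *)
Definition interval_rank A e :=
  if e \in A then (size s - index e s)%N else ((size s).+1 + index e s)%N.

(** Ranks are at most [size s] on A and exceed it elsewhere, and on each side the rank determines
    the index. *)
Lemma interval_rank_inj A : {in edges G &, injective (interval_rank A)}.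
Proof.
move=> e f eG fG; rewrite /interval_rank => h; apply: index_edges_inj => //=.
have := index_le e; have := index_le f; move: h.
by case: ifP => _; case: ifP => _; lia.
Qed.

(** Compare a tree edge e with an f outside T in its cut. For f in A greediness forces f before e,
    which over all such e is external activity of f. For e outside A it forces e before f, which
    over all such f is internal activity of e. *)
Lemma interval_greedy T A :
    T \in spanning_trees G -> A \subset edges G ->
  (II T \subset A) && (A \subset T :|: EA T) <->
  (forall e f, e \in T -> f \in Defs.cut G T e ->
     (interval_rank A e <= interval_rank A f)%N).
Proof.
move=> TT AG; have [TG _ _] := spanning_treeP _ _ TT.
(* Excludes e outside A with f in A: both index inequalities would hold, making the indices
   equal. *)
have idx e f : e \in T -> f \in edges G :\: T -> index e s = index f s -> False.
  move=> eT /setDP[fG nfT] /index_edges_inj ef.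
  by rewrite -ef ?eT // (subsetP TG) in nfT.
split=> [/andP[/subsetP IA /subsetP AE] e f eT fcut|gT].
  have [->//|fT] := cutP TT eT fcut; have [fG nfT] := setDP fT.
  have fA_lt : f \in A -> (index f s <= index e s)%N.
    move=> /AE; rewrite inE (negPf nfT) /= => /(ext_activeP TT fT); exact.
  have eA_lt : e \notin A -> (index e s <= index f s)%N.
    move=> neA; have : e \in int_active G s T.
      by apply: contraR neA => ne; apply: IA; rewrite inE ne.
    by move/(int_activeP TT eT); apply.
  have := index_le e; have := index_le f; have := @idx e f eT fT.
  move: fA_lt eA_lt; rewrite /interval_rank.
  by case: (e \in A); case: (f \in A) => /=; lia.
apply/andP; split; apply/subsetP => e.
  case/setDP=> eT; apply: contraR => neA; apply/(int_activeP TT eT) => f fcut.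
  have := gT e f eT fcut; rewrite /interval_rank (negPf neA).
  by case: ifP => _; lia.
move=> eA; rewrite inE; case eT : (e \in T) => //=.
have eD : e \in edges G :\: T by rewrite inE eT (subsetP AG).
apply/(ext_activeP TT eD) => f fT ecut.
have := gT f e fT ecut; rewrite /interval_rank eA.
have := index_size e s; have := index_size f s.
have : (index e s < size s)%N by rewrite index_mem s_edges (subsetP AG).
by case: ifP => _; lia.
Qed.

Lemma int_inactive_sub T : II T \subset T.
Proof. exact: subsetDl. Qed.

Lemma crapo_expansion (R : comPzRingType) (t : E -> R) :
  \prod_(e in edges G) (1 + t e) =
  \sum_(T in spanning_trees G)
    (\prod_(e in II T) t e) * (\prod_(e in (T :|: EA T) :\: II T) (1 + t e)).
Proof.
have /esym := prod_subset_interval t (sub0set (edges G)).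
rewrite big_set0 mul1r setD0 => <-.
under [RHS]eq_bigr => T TT.
  rewrite prod_subset_interval; first over.
  exact: subset_trans (int_inactive_sub T) (subsetUl _ _).
rewrite (exchange_big_dep (fun A : {set E} => A \subset edges G)) /=.
  apply: eq_big => [A|A]; rewrite sub0set //= => AG.
  have [T0 TT0 gT0] := greedy_tree_exists G (interval_rank A).
  (* Exactly one interval contains A, that of its greedy tree [T0]. *)
  rewrite (big_pred1 T0) // => T /=; apply/andP/eqP => [[TT iT]|->].
    apply: (greedy_tree_unique (@interval_rank_inj A) TT TT0 _ gT0).
    exact: (interval_greedy TT AG).1.
  by split=> //; apply: (interval_greedy TT0 AG).2.
move=> T A /spanning_treeP[TG _ _] /andP[_ /subset_trans]; apply.
by rewrite subUset TG; apply/subsetP => e /setIdP[/setDP[]].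
Qed.

End Activities.

(** * Contraction *)

Section ContractEdge.
Variables (C : pzRingType) (q : nat) (E : finType) (G : potts_graph C q E).
Variable e : E.
Implicit Types (A : {set E}) (f : E) (x : vert G).

Lemma contract_mapNone x : (contract_map e x == None) = is_end e x.
Proof. by rewrite /contract_map; case: insubP => [u /negPf-> //|/negPn->]. Qed.

Lemma contract_mapSome x (y : {x : vert G | ~~ is_end e x}) :
  (contract_map e x == Some y) = (x == val y).
Proof.
rewrite /contract_map; case: insubP => [u _ <- //|/negPn ex].
by apply/esym/negP => /eqP xy; move: (valP y); rewrite -xy ex.
Qed.

Lemma contract_map_end1 : contract_map e (ends G e).1 = None.
Proof. by apply/eqP; rewrite contract_mapNone /is_end eqxx. Qed.

Lemma contract_map_end2 : contract_map e (ends G e).2 = None.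
Proof. by apply/eqP; rewrite contract_mapNone /is_end eqxx orbT. Qed.

(** Descends a colouring that agrees at the ends of e to the contracted graph; serves for
    connectivity and for states. *)
Definition lift_colouring (X : Type) (g : vert G -> X) : contract_vert G e -> X :=
  fun y => if y is Some x then g (val x) else g (ends G e).1.

Lemma lift_colouringK (X : Type) (g : vert G -> X) :
    g (ends G e).1 = g (ends G e).2 ->
  forall x, lift_colouring g (contract_map e x) = g x.
Proof.
move=> ge x; case def: (contract_map e x) => [y|] /=.
  by move/eqP: def; rewrite contract_mapSome => /eqP->.
by move/eqP: def; rewrite contract_mapNone => /orP[]/eqP->.
Qed.

Lemma linked_contract A f :
  linked (contract G e) A f -> linked G (e |: A) f.
Proof.
(* Reachability from an end of f in [e |: A] is constant along e, so it descends to the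
   contraction. *)
move=> lf; pose g := connect (adj (e |: A)) (ends G f).1.
have ge h : h \in e |: A -> g (ends G h).1 = g (ends G h).2.
  by move=> hA; apply/conn_saturated/linked1.
have gK := lift_colouringK (ge e (setU11 _ _)).
have : lift_colouring g (contract_map e (ends G f).1) =
       lift_colouring g (contract_map e (ends G f).2).
  apply: (conn_colouring _ lf) => h hA /=.
  by rewrite !gK ge // setU1r.
by rewrite !gK /g connect0.
Qed.

Lemma forest_contract A :
  e \notin A -> forest G (e |: A) -> forest (contract G e) A.
Proof.
move=> neA /forestP fA; apply/forestP => f fA'.
apply: contra (fA f (setU1r _ fA')) => /linked_contract.
apply: linkedS; rewrite setDUl setSU // subsetD1 subxx inE.
by apply: contraNneq neA => <-.
Qed.

End ContractEdge.

Section ContractStates.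
Variables (R : realType) (q : nat) (E : finType) (G : potts_graph R[i] q E).
Variable e : E.

Definition pull_state (sigma : state (contract G e)) : state G :=
  [ffun x => sigma (contract_map e x)].

Lemma sum_contract_state (S : nmodType) (P : pred (state G)) (F : state G -> S) :
  \sum_(sigma : state (contract G e) | P (pull_state sigma)) F (pull_state sigma) =
  \sum_(sigma : state G | (sigma (ends G e).1 == sigma (ends G e).2) && P sigma)
    F sigma.
Proof.
rewrite [RHS](reindex pull_state) /=.
  apply: eq_bigl => sigma.
  by rewrite !ffunE contract_map_end1 contract_map_end2 eqxx.
exists (fun sigma => [ffun y => lift_colouring sigma y] : state (contract G e)).
  move=> sigma _; apply/ffunP => -[x|]; rewrite !ffunE /= ffunE.
    by congr (sigma _); apply/eqP; rewrite contract_mapSome.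
  by rewrite contract_map_end1.
move=> sigma /andP[/eqP se _]; apply/ffunP => x; rewrite !ffunE.
exact: lift_colouringK.
Qed.

(** The fibres of the contraction map are singletons except the one over [None], which consists of
    the two distinct ends of e; there the weights add up. *)
Lemma sum_contract_field (sigma : state (contract G e)) :
    (ends G e).1 != (ends G e).2 ->
  \sum_v \sum_a field_vec (contract G e) v 0 a * (a == sigma v)%:R =
  \sum_v \sum_a field_vec G v 0 a * (a == pull_state sigma v)%:R.
Proof.
move=> nloop; rewrite [RHS](partition_big (contract_map e) predT) //=.
apply: eq_bigr => -[y|] _ /=.
  rewrite (big_pred1 (val y)) => [|x]; last exact: contract_mapSome.
  apply: eq_bigr => a _; rewrite ffunE; congr (_ * (a == sigma _)%:R).
  by apply/esym/eqP; rewrite contract_mapSome.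
rewrite (bigD1 (ends G e).1) /=; last by rewrite contract_map_end1.
rewrite (big_pred1 (ends G e).2) => [|x] /=; last first.
  rewrite contract_mapNone /is_end; case: (eqVneq x (ends G e).1) => [->|] /=.
    by rewrite (negPf nloop).
  by rewrite andbT.
rewrite -big_split; apply: eq_bigr => a _ /=.
by rewrite !ffunE contract_map_end1 contract_map_end2 mxE mulrDl.
Qed.

End ContractStates.

(** * Complex exponentials and the expansion of the partition function *)

Lemma cexpD (R : realType) (x y : R[i]) : cexp (x + y) = cexp x * cexp y.
Proof.
case: x y => [a b] [c d]; apply/eqP; rewrite eq_complex /=.
by rewrite expRD cosD sinD; apply/andP; split; apply/eqP; ring.
Qed.

Lemma cexp0 (R : realType) : cexp (0 : R[i]) = 1.
Proof. by rewrite /cexp /= expR0 cos0 sin0 mulr1 mulr0. Qed.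

Lemma cexp_sum (R : realType) (I : finType) (P : pred I) (F : I -> R[i]) :
  cexp (\sum_(i | P i) F i) = \prod_(i | P i) cexp (F i).
Proof. by apply: (big_morph _ (@cexpD R) (@cexp0 R)). Qed.

Section Expansion.
Variables (R : realType) (q : nat) (E : finType) (beta : R[i]).
Implicit Type G : potts_graph R[i] q E.

Definition agree G (sigma : state G) (e : E) :=
  sigma (ends G e).1 == sigma (ends G e).2.

Definition field_weight G (sigma : state G) :=
  cexp (beta * \sum_v \sum_a field_vec G v 0 a * (a == sigma v)%:R).

Definition bond_term G (sigma : state G) (e : E) :=
  (cexp (beta * energy G e) - 1) * (agree sigma e)%:R.

(** The Kronecker delta is 0 or 1, so the Boltzmann factor of an edge is [1 + bond_term sigma e]. *)
Lemma Zext_prod G :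
  Zext beta G =
  \sum_(sigma : state G)
    field_weight sigma * \prod_(e in edges G) (1 + bond_term sigma e).
Proof.
apply: eq_bigr => sigma _; rewrite /hamiltonian.
set B := \sum_(e in _) _; set F := \sum_v _.
have -> : - beta * (- B - F) = beta * F + beta * B by ring.
rewrite cexpD; congr (_ * _); rewrite /B mulr_sumr cexp_sum.
apply: eq_bigr => e _.
rewrite /bond_term /agree; case: (_ == _); rewrite ?mulr1 ?mulr0 ?addr0 ?cexp0 //.
by rewrite addrC subrK.
Qed.

Lemma agree_pull G e (sigma : state (contract G e)) f :
  agree (pull_state sigma) f = agree sigma f.
Proof. by rewrite /agree !ffunE. Qed.

Lemma Zext_contract_seq (l : seq E) G :
    uniq l -> forest G [set e in l] ->
  Zext beta (foldl (@contract _ q E) G l) =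
  \sum_(sigma : state G | all (agree sigma) l)
    field_weight sigma * \prod_(e in edges G :\: [set e in l]) (1 + bond_term sigma e).
Proof.
elim: l G => [|e l IH] G /=.
  move=> _ _; rewrite Zext_prod; apply: eq_bigr => sigma _.
  by congr (_ * _); apply: eq_bigl => e; rewrite !inE.
move=> /andP[nel ul]; rewrite set_cons => fG.
have nel' : e \notin [set f in l] by rewrite inE.
(* A loop is linked by every set, so a forest contains none. *)
have nloop : (ends G e).1 != (ends G e).2.
  move/forestP: fG => /(_ e (setU11 _ _)); apply: contraNneq => h.
  by rewrite /linked h connect0.
rewrite IH //; last exact: forest_contract.
rewrite -sum_contract_state; apply: eq_big => [sigma|sigma _].
  by apply: eq_all => f; rewrite agree_pull.
rewrite /field_weight sum_contract_field //; congr (_ * _).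
apply: eq_big => [f|f _]; first by rewrite !inE negb_or andbA [(f != e) && _]andbC.
by rewrite /bond_term agree_pull.
Qed.

Lemma Zext_contract_set G (A : {set E}) :
    forest G A ->
  Zext beta (contract_set G A) =
  \sum_(sigma : state G | [forall e in A, agree sigma e])
    field_weight sigma * \prod_(e in edges G :\: A) (1 + bond_term sigma e).
Proof.
have defA : [set e in enum A] = A by apply/setP => e; rewrite inE mem_enum.
move=> fA; rewrite Zext_contract_seq ?enum_uniq ?defA //.
apply: eq_bigl => sigma; apply/allP/forall_inP => h e.
  by move=> eA; apply: h; rewrite mem_enum.
by rewrite mem_enum; apply: h.
Qed.

Lemma agree_linked G (sigma : state G) (A : {set E}) e :
  [forall f in A, agree sigma f] -> linked G A e -> agree sigma e.
Proof.
by move=> /forall_inP h le; apply/eqP; apply: conn_colouring le => f /h/eqP.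
Qed.

End Expansion.

Theorem theorem3p3 (R : realType) (q : nat) (E : finType) (beta : R[i])
    (G : potts_graph R[i] q E) (s : seq E)
    (hq : (1 <= q)%N) (s_uniq : uniq s) (s_edges : s =i edges G) :
  Zext beta G =
    \sum_(T in spanning_trees G)
      (\prod_(e in int_inactive G s T) (cexp (beta * energy G e) - 1)) *
      (\prod_(e in ext_active G s T) cexp (beta * energy G e)) *
      Zext beta (contract_set (spanning_subgraph G T) (int_inactive G s T)).
Proof.
rewrite Zext_prod.
under eq_bigr => sigma _ do rewrite (crapo_expansion s_edges) mulr_sumr.
rewrite exchange_big /=; apply: eq_bigr => T TT.
set II := int_inactive G s T; set EA := ext_active G s T.
have [TG fT _] := spanning_treeP _ _ TT.
have IIT : II \subset T by apply: int_inactive_sub.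
rewrite Zext_contract_set; last exact: (forestS IIT fT).
rewrite [RHS]mulr_sumr [RHS]big_mkcond /=; apply: eq_bigr => sigma _.
(* A state that disagrees on an edge of II contributes 0, through the factor of that edge. *)
case: ifP => [agr|/negbT]; last first.
  rewrite negb_forall_in => /exists_inP[e eII nag].
  rewrite (big_setD1 e eII) /= {1}/bond_term.
  have -> : agree sigma e = false by apply: negbTE nag.
  by rewrite mulr0 !mul0r mulr0.
have TEA : [disjoint T & EA].
  rewrite disjoint_sym disjoints_subset; apply/subsetP => e.
  by rewrite !inE => /andP[/andP[]].
have defD : (T :|: EA) :\: II = (T :\: II) :|: EA.
  rewrite setDUl; congr (_ :|: _); apply/setDidPl.
  by rewrite disjoint_sym (disjointWl IIT).
have -> : \prod_(e in (T :|: EA) :\: II) (1 + bond_term beta sigma e) =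
    (\prod_(e in T :\: II) (1 + bond_term beta sigma e)) *
    (\prod_(e in EA) (1 + bond_term beta sigma e)).
  rewrite -bigU; last exact: (disjointWl (subsetDl _ _) TEA).
  by apply: eq_bigl => e; rewrite defD in_setU.
(* Agreement along II spreads to the ends of every externally active edge, which II links. *)
have -> : \prod_(e in EA) (1 + bond_term beta sigma e) =
          \prod_(e in EA) cexp (beta * energy G e).
  apply: eq_bigr => e eEA; rewrite /bond_term.
  have -> : agree sigma e.
    exact: (agree_linked agr (ext_active_linked s_edges TT eEA)).
  by rewrite mulr1 addrC subrK.
have -> : \prod_(e in II) bond_term beta sigma e =
          \prod_(e in II) (cexp (beta * energy G e) - 1).
  apply: eq_bigr => e eII; rewrite /bond_term.
  have -> : agree sigma e by move/forall_inP: agr; apply.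
  by rewrite mulr1.
rewrite mulrCA -mulrA; congr (_ * _).
by rewrite [LHS]mulrA [LHS]mulrC.
Qed.
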